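(* Let $N\ge 2$. There exist $\epsilon_0>0$, $\gamma_0>0$, $\Delta>0$ and $r>0$ such that for all real $\epsilon,\gamma,\omega$ with $|\epsilon|<\epsilon_0$, $|\gamma|<\gamma_0$ and $|\omega-1|<\Delta$ there is a unique value $\beta\in\mathbb{R}$ for which the damped and driven system $$\dot p_j=\epsilon(\Delta q)_j+\omega q_j-(p_j^2+q_j^2)q_j+\beta\delta_{j,1}p_1-\gamma\delta_{j,N}p_N,$$ $$\dot q_j=-\epsilon(\Delta p)_j-\omega p_j+(p_j^2+q_j^2)p_j+\beta\delta_{j,1}q_1-\gamma\delta_{j,N}q_N,\qquad j=1,\dots,N,$$ has a stationary solution $(p,q)\in\mathbb{R}^{2N}$ in the ball of radius $r$ centred at the undamped breather $(p^*(\epsilon,\omega),0)$. Moreover, this family of fixed points (taken modulo the rotations $p_j+iq_j\mapsto e^{i\theta}(p_j+iq_j)$, that is, normalized by $q_1=0$, $p_1>0$) depends smoothly on $\gamma$, $\omega$ and $\epsilon$.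
   Context: Here $p=(p_1,\dots,p_N)$ and $q=(q_1,\dots,q_N)$ are real vectors, $\delta_{j,k}$ is the Kronecker delta, and $\Delta$ acting on a vector is the discrete Laplacian with free ends: $(\Delta p)_1=p_2-p_1$, $(\Delta p)_j=p_{j+1}+p_{j-1}-2p_j$ for $2\le j\le N-1$, and $(\Delta p)_N=p_{N-1}-p_N$ (the scalar $\Delta>0$ in the claim is just a constant). With $\zeta_j=p_j+iq_j$ and $z_j(t)=e^{i\omega t}\zeta_j(t)$, the system is the damped and driven discrete nonlinear Schrödinger equation $-i\dot z_j=-\epsilon(\Delta z)_j+|z_j|^2z_j-i\beta\delta_{j,1}z_1+i\gamma\delta_{j,N}z_N$ written in a rotating frame. It is invariant under $\zeta_j\mapsto e^{i\theta}\zeta_j$ (the same $\theta\in\mathbb{R}$ for all $j$). Undamped breather (known result): for $\beta=\gamma=0$, for all sufficiently small $|\epsilon|$ and $|\omega-1|$ the system has a family of fixed points $(p^*(\epsilon,\omega),0)$ (all $q_j=0$), varying smoothly with $\epsilon$ and $\omega$, with $p_1^*=1+O(\epsilon,|1-\omega|)$ and $p_j^*=O(\epsilon^{j-1})$ for $j=2,\dots,N$. It is the unique fixed point in a neighborhood of $p=(1,0,\dots,0)$, $q=0$, up to the complex rotations. *)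

(* Defs.v *)
(* Library: MathComp and MathComp-Analysis. *)
From HB Require Import structures.
From mathcomp Require Import all_boot all_order all_algebra.
From mathcomp Require Import all_classical all_reals all_analysis.

Set Implicit Arguments.
Unset Strict Implicit.
Unset Printing Implicit Defensive.

Import Order.TTheory GRing.Theory Num.Theory.
Import numFieldNormedType.Exports.

Local Open Scope classical_set_scope.
Local Open Scope ring_scope.

(* C^k regularity on U, meant for U open: at points of the interior the total
   operator 'D_v only involves the values of f in U. In finite dimension this is
   the usual notion, since the 'D_v f include all partial derivatives. *)
Fixpoint class_C {R : realType} {V W : normedModType R}
    (k : nat) (U : set V) (f : V -> W) : Prop :=
  match k with
  | 0 => forall x, U x -> {for x, continuous f}
  | k'.+1 => (forall x, U x -> differentiable f x) /\
             (forall v : V, class_C k' U (fun x => 'D_v f x))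
  end.

Definition smooth_on {R : realType} {V W : normedModType R}
    (U : set V) (f : V -> W) : Prop := forall k, class_C k U f.

(* The chain has N = n.+2 >= 2 sites; site j of the mathematics is the ordinal
   j - 1, so site 1 is ord0 and site N is ord_max. *)

Definition laplacian {R : realType} {n : nat} (p : 'rV[R]_n.+2) : 'rV[R]_n.+2 :=
  \row_j (if j == ord0 then p 0 (inord 1) - p 0 ord0
          else if j == ord_max then p 0 (inord n) - p 0 ord_max
          else p 0 (inord j.+1) + p 0 (inord j.-1) - 2 * p 0 j).

Definition velocity_p {R : realType} {n : nat} (eps omega beta gamma : R)
    (p q : 'rV[R]_n.+2) : 'rV[R]_n.+2 :=
  \row_j (eps * laplacian q 0 j + omega * q 0 j
          - (p 0 j ^+ 2 + q 0 j ^+ 2) * q 0 j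
          + beta * (j == ord0)%:R * p 0 ord0
          - gamma * (j == ord_max)%:R * p 0 ord_max).

Definition velocity_q {R : realType} {n : nat} (eps omega beta gamma : R)
    (p q : 'rV[R]_n.+2) : 'rV[R]_n.+2 :=
  \row_j (- (eps * laplacian p 0 j) - omega * p 0 j
          + (p 0 j ^+ 2 + q 0 j ^+ 2) * p 0 j
          + beta * (j == ord0)%:R * q 0 ord0
          - gamma * (j == ord_max)%:R * q 0 ord_max).

Definition stationary {R : realType} {n : nat} (eps omega beta gamma : R)
    (p q : 'rV[R]_n.+2) : Prop :=
  velocity_p eps omega beta gamma p q = 0 /\
  velocity_q eps omega beta gamma p q = 0.

(* Euclidean distance on R^(2N); the library's norm on row vectors is the
   sup norm. *)
Definition dist2 {R : realType} {n : nat} (p q p' q' : 'rV[R]_n) : R :=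
  Num.sqrt (\sum_j ((p 0 j - p' 0 j) ^+ 2 + (q 0 j - q' 0 j) ^+ 2)).

(* (p', q') is the image of (p, q) under p_j + i q_j |-> e^(i theta) (p_j + i q_j)
   for some theta. *)
Definition rotation_of {R : realType} {n : nat} (p q p' q' : 'rV[R]_n) : Prop :=
  exists theta : R, p' = cos theta *: p - sin theta *: q /\
                    q' = sin theta *: p + cos theta *: q.

(* pstar eps omega is the undamped breather: the family of real fixed points
   for beta = gamma = 0 bifurcating from p = (1, 0, ..., 0), q = 0. *)
Definition undamped_breather {R : realType} {n : nat}
    (pstar : R -> R -> 'rV[R]_n.+2) : Prop :=
  exists eps1 delta1 : R, [/\ 0 < eps1, 0 < delta1 &
    let U := [set x : R * R | `|x.1| < eps1 /\ `|x.2 - 1| < delta1] in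
    [/\ forall eps omega, U (eps, omega) ->
          stationary eps omega 0 0 (pstar eps omega) 0,
        smooth_on U (fun x => pstar x.1 x.2),
        exists C : R, forall eps omega, U (eps, omega) ->
          `|pstar eps omega 0 ord0 - 1| <= C * (`|eps| + `|1 - omega|) /\
          (forall j : 'I_n.+2, j != ord0 ->
             `|pstar eps omega 0 j| <= C * `|eps| ^+ j) &
        exists2 rho : R, 0 < rho & forall eps omega, U (eps, omega) ->
          dist2 (pstar eps omega) 0 (delta_mx 0 ord0) 0 < rho /\
          forall p q : 'rV[R]_n.+2,
            dist2 p q (delta_mx 0 ord0) 0 < rho ->
            stationary eps omega 0 0 p q ->
            rotation_of (pstar eps omega) 0 p q]].

(* Main.v *)
Require Import Defs.
From HB Require Import structures.
From mathcomp Require Import all_boot all_order all_algebra.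
From mathcomp Require Import ring lra.
From mathcomp Require Import all_classical all_reals all_analysis.
Import Order.TTheory GRing.Theory Num.Theory.
Import numFieldNormedType.Exports.
Local Open Scope classical_set_scope.
Local Open Scope ring_scope.

Set Implicit Arguments.
Unset Strict Implicit.
Unset Printing Implicit Defensive.

(** In complex notation zeta_j = p_j + i q_j a stationary point satisfies
    [- eps (Lap zeta)_j - omega zeta_j + |zeta_j|^2 zeta_j
     - i beta delta_(j,1) zeta_1 + i gamma delta_(j,N) zeta_N = 0].
    The equations are covariant under a common rotation of all zeta_j, so near
    the breather one may rotate until q_1 = 0 and p_1 > 0
    ([rotate_to_positive_real], [stationary_rotation]). Then beta occurs in one
    real equation only, the p-equation of site 1, which reads
    [beta p_1 = - eps (Lap q)_1] and determines beta from the rest. The other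
    2N - 1 real equations, together with q_1 = 0, are rewritten as a fixed-point
    equation x = Phi(x) for the 2 x N matrix x with rows p and q
    ([breather_map], [fixed_point_stationary], [stationary_fixed_point]). At
    eps = gamma = 0, omega = 1 the derivative of Phi at the base point
    p = (1, 0, ..., 0), q = 0 vanishes, so Phi is a 1/2-contraction of a fixed
    sup-norm ball of radius 1/10 for all small parameters. Banach's theorem gives
    the branch, and contraction gives its uniqueness. The undamped breather is
    close to the base point, so a small ball around it is mapped into the
    contraction ball by the normalizing rotation ([normalized_near_base]).

    Smoothness of the fixed point in the parameters comes without an implicit
    function theorem. As Phi is polynomial in x, and affine in the parameters,
    differences of Phi factor exactly:
    [X b - X a = A (X b - X a) + sum_l (c_l b - c_l a) T_l (X a)], where A is a
    linear operator of norm at most 1/2 depending polynomially on b, X b, X a.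
    Hence [X b - X a = sum_l (c_l b - c_l a) (1 - A)^-1 T_l (X a)], which both
    exhibits X as differentiable and gives its derivatives as rational
    expressions in X and the parameters. So X is as smooth as its derivative
    is, and induction on the order of differentiability concludes
    ([smooth_fixed_point]). *)

(** * Calculus of C^k maps *)

Section ClassCGeneral.
Context {R : realType} {V W : normedModType R}.
Implicit Types (U : set V) (f g : V -> W).

Lemma class_C_continuous k U f x : class_C k U f -> U x -> {for x, continuous f}.
Proof.
case: k => [|k] /=; first by move=> h /h.
by move=> [h _] /h; apply: differentiable_continuous.
Qed.

Lemma class_CW k U f : class_C k.+1 U f -> class_C k U f.
Proof.
elim: k f => [|k IH] f /=; first by move=> [h _] x /h; apply: differentiable_continuous.
by move=> [h1 h2]; split=> // v; apply: IH; apply: h2.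
Qed.

(** The difference vanishes near x, hence is an o(h) with zero differential. *)
Lemma near_eq_differentiable f g x :
  (\near x, f x = g x) -> differentiable f x -> differentiable g x.
Proof.
move=> fg df.
have -> : g = f + (g - f) by rewrite addrC subrK.
apply: differentiableD => //.
apply/diff_locallyP.
have fgx : f x = g x by exact: nbhs_singleton fg.
move: fg; rewrite (near_shift 0) subr0 => fg.
have E : (g - f) \o shift x = cst ((g - f) x) + (\0 : V -> W) +o_ 0 id.
  apply/eqaddoP => e e0; near=> h.
  have -> : ((g - f) \o shift x - (cst ((g - f) x) + 0)) h = 0.
    rewrite !fctE /= fgx subrr add0r subr0.
    by rewrite (_ : f (h + x) = g (h + x)) ?subrr //; near: h.
  by rewrite normr0 mulr_ge0 // ltW.
have H := @diff_unique _ _ _ (g - f) (\0 : {linear V -> W}) x _ E.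
have c0 : continuous (\0 : V -> W) by move=> y; exact: cvg_cst.
by rewrite (H c0); split; first exact: c0.
Unshelve. all: by end_near. Qed.

(** The recursive clause of [class_C] quantifies over the total function
    [fun x => 'D_v f x]; openness of U makes its values on U depend only on f
    on U. This is what allows an explicit formula for a derivative, valid on U
    only, to be used in inductions on k. *)
Lemma class_C_ext k U f g :
  open U -> (forall x, U x -> f x = g x) -> class_C k U f -> class_C k U g.
Proof.
move=> oU; elim: k f g => [|k IH] f g fg /=.
  move=> h x Ux.
  have fgn : \near x, f x = g x.
    by near=> y; apply: fg; near: y; apply: open_nbhs_nbhs.
  have fx : f @ x --> g x by rewrite -fg //; exact: h.
  exact: cvg_trans (near_eq_cvg fgn) fx.
move=> [h1 h2]; have fgn x : U x -> \near x, f x = g x.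
  by move=> Ux; near=> y; apply: fg; near: y; apply: open_nbhs_nbhs.
split=> [x Ux|v]; first by apply: near_eq_differentiable (fgn x Ux) (h1 x Ux).
by apply: IH (h2 v) => x Ux; apply: near_eq_derive; exact: fgn.
Unshelve. all: by end_near. Qed.

Lemma class_C_cst k U (w : W) : class_C k U (fun=> w).
Proof.
elim: k w => [|k IH] w /=; first by move=> x _; exact: cst_continuous.
split=> [x _|v]; first exact: differentiable_cst.
have -> : (fun x : V => 'D_v (fun=> w) x) = fun=> 0.
  by apply/funext => x; exact: derive_cst.
exact: IH.
Qed.

Lemma class_CD k U f g : open U -> class_C k U f -> class_C k U g ->
  class_C k U (fun x => f x + g x).
Proof.
move=> oU; elim: k f g => [|k IH] f g /=.
  by move=> hf hg x Ux; apply: continuousD; [exact: hf|exact: hg].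
move=> [f1 f2] [g1 g2]; split=> [x Ux|v].
  by apply: differentiableD; [exact: f1|exact: g1].
apply: class_C_ext (IH _ _ (f2 v) (g2 v)) => // x Ux.
by rewrite -deriveD //; apply: diff_derivable; [exact: f1|exact: g1].
Qed.

Lemma class_C_sum k U (I : Type) (r : seq I) (P : pred I) (f : I -> V -> W) :
  open U -> (forall i, P i -> class_C k U (f i)) ->
  class_C k U (fun x => \sum_(i <- r | P i) f i x).
Proof.
move=> oU hf; elim: r => [|i r IH].
  have -> : (fun x => \sum_(i <- [::] | P i) f i x) = fun=> 0.
    by apply/funext => x; rewrite big_nil.
  exact: class_C_cst.
have -> : (fun x => \sum_(j <- i :: r | P j) f j x) =
    fun x => (if P i then f i x else 0) + \sum_(j <- r | P j) f j x.
  by apply/funext => x; rewrite big_cons; case: ifP => // _; rewrite add0r.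
apply: class_CD => //; case: (boolP (P i)) => Pi; first exact: hf.
exact: class_C_cst.
Qed.

End ClassCGeneral.

Section ClassCScalar.
Context {R : realType} {V : normedModType R}.
Implicit Types (U : set V) (f g : V -> R).

Lemma class_CM k U f g : open U -> class_C k U f -> class_C k U g ->
  class_C k U (fun x => f x * g x).
Proof.
move=> oU; elim: k f g => [|k IH] f g.
  by move=> hf hg x Ux; apply: continuousM; [exact: hf|exact: hg].
move=> hf hg; have [[f1 f2] [g1 g2]] := (hf, hg); split=> [x Ux|v].
  by apply: differentiableM; [exact: f1|exact: g1].
have h := class_CD oU (IH _ _ (class_CW hf) (g2 v)) (IH _ _ (class_CW hg) (f2 v)).
apply: class_C_ext h => // x Ux.
rewrite -[RHS]/('D_v (f * g) x) deriveM //.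
- by apply: diff_derivable; exact: f1.
- by apply: diff_derivable; exact: g1.
Qed.

Lemma class_C_prod k U (I : Type) (r : seq I) (P : pred I) (f : I -> V -> R) :
  open U -> (forall i, P i -> class_C k U (f i)) ->
  class_C k U (fun x => \prod_(i <- r | P i) f i x).
Proof.
move=> oU hf; elim: r => [|i r IH].
  have -> : (fun x => \prod_(i <- [::] | P i) f i x) = fun=> 1.
    by apply/funext => x; rewrite big_nil.
  exact: class_C_cst.
have -> : (fun x => \prod_(j <- i :: r | P j) f j x) =
    fun x => (if P i then f i x else 1) * \prod_(j <- r | P j) f j x.
  by apply/funext => x; rewrite big_cons; case: ifP => // _; rewrite mul1r.
apply: class_CM => //; case: (boolP (P i)) => Pi; first exact: hf.
exact: class_C_cst.
Qed.

Lemma class_CV k U f : open U -> (forall x, U x -> f x != 0) ->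
  class_C k U f -> class_C k U (fun x => (f x)^-1).
Proof.
move=> oU f0; elim: k => [|k IH].
  by move=> hf x Ux; apply: continuousV; [exact: f0|exact: hf].
move=> hf; have [f1 f2] := hf; split=> [x Ux|v].
  by apply: differentiableV; [exact: f1|exact: f0].
have hV := IH (class_CW hf).
have h := class_CM oU (class_C_cst k U (-1 : R)) (class_CM oU (class_CM oU hV hV) (f2 v)).
apply: class_C_ext h => // x Ux.
rewrite deriveV ?f0 //; last by apply: diff_derivable; exact: f1.
by rewrite mulN1r /GRing.scale /= mulNr expr2 invfM.
Qed.

Lemma class_C_linear k U (f : {linear V -> R}) : continuous f -> class_C k U f.
Proof.
move=> cf; case: k => [|k] /=; first by move=> x _; exact: cf.
split=> [x _|v]; first exact: linear_differentiable.
have -> : (fun x => 'D_v f x) = fun=> f v; last exact: class_C_cst.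
by apply/funext => x; rewrite deriveE ?diff_lin //; exact: linear_differentiable.
Qed.

End ClassCScalar.

Section ClassCRing.
Context {R : realType} {V : normedModType R}.
Implicit Types (U : set V) (f g : V -> R).

Lemma class_CN k U f : open U -> class_C k U f -> class_C k U (fun x => - f x).
Proof.
move=> oU hf; have -> : (fun x => - f x) = fun x => -1 * f x.
  by apply/funext => x; rewrite mulN1r.
by apply: class_CM => //; exact: class_C_cst.
Qed.

Lemma class_CX k U f e : open U -> class_C k U f -> class_C k U (fun x => f x ^+ e).
Proof.
move=> oU hf; elim: e => [|e IH]; first exact: (class_C_cst k U (1 : R)).
have -> : (fun x => f x ^+ e.+1) = fun x => f x * f x ^+ e.
  by apply/funext => x; rewrite exprS.
exact: class_CM.
Qed.

End ClassCRing.

Section ClassCMatrix.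
Context {R : realType} {V : normedModType R}.
Implicit Types (U : set V).

Lemma class_CZl {W : normedModType R} k U (f : V -> R) (w : W) :
  open U -> class_C k U f -> class_C k U (fun x => f x *: w).
Proof.
move=> oU; elim: k f => [|k IH] f /=.
  by move=> hf x Ux; apply: continuousZr_tmp; exact: hf.
move=> [f1 f2]; split=> [x Ux|v]; first by apply: differentiableZl; exact: f1.
apply: class_C_ext (IH _ (f2 v)) => // x Ux.
rewrite !deriveE ?diffZl //; do ?exact: f1.
by apply: differentiableZl; exact: f1.
Qed.

Lemma class_C_mx k U m n (M : V -> 'M[R]_(m, n)) : open U ->
  (forall i j, class_C k U (fun x => M x i j)) -> class_C k U M.
Proof.
move=> oU hM.
have -> : M = fun x => \sum_i \sum_j M x i j *: delta_mx i j.
  by apply/funext => x; exact: matrix_sum_delta.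
by do 2!apply: class_C_sum => // ? _; exact: class_CZl.
Qed.

Lemma class_C_det k U m (A : V -> 'M[R]_m) : open U ->
  (forall i j, class_C k U (fun x => A x i j)) ->
  class_C k U (fun x => \det (A x)).
Proof.
move=> oU hA; apply: class_C_sum => // s _; apply: class_CM => //.
  exact: class_C_cst.
by apply: class_C_prod.
Qed.

(** Cramer's rule makes the entries of the inverse rational in those of the
    matrix. *)
Lemma class_C_invmx k U m (A : V -> 'M[R]_m) : open U ->
  (forall i j, class_C k U (fun x => A x i j)) ->
  (forall x, U x -> A x \in unitmx) ->
  forall i j, class_C k U (fun x => invmx (A x) i j).
Proof.
move=> oU hA uA i j.
have hdet := class_C_det oU hA.
have h : class_C k U (fun x => (\det (A x))^-1 * cofactor (A x) j i).
  apply: class_CM => //.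
    by apply: class_CV => // x /uA; rewrite unitmxE unitfE.
  apply: class_CM => //; first exact: class_C_cst.
  apply: class_C_det => // p q.
  have -> : (fun x => row' j (col' i (A x)) p q) = fun x => A x (lift j p) (lift i q).
    by apply/funext => x; rewrite !mxE.
  exact: hA.
by apply: class_C_ext h => // x /uA uAx; rewrite /invmx uAx !mxE.
Qed.

End ClassCMatrix.

(** * Solving Y = A Y + B *)

Section AffineSolve.
Context {R : realType} {m n : nat}.
Implicit Types (A : {linear 'M[R]_(m, n) -> 'M[R]_(m, n)}) (B Y : 'M[R]_(m, n)).

(** The solution Y of Y = A Y + B when 1 - A is invertible, computed on
    the row vectors [mxvec Y], so that its smooth dependence on A and B reduces
    to that of a matrix inverse. *)
Definition affine_solve A B : 'M[R]_(m, n) :=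
  vec_mx (mxvec B *m invmx (1%:M - lin_mx A)).

(** A vector in the kernel of 1 - A is fixed by A, hence at most half as long
    as itself. *)
Lemma contraction_unitmx A : (forall Y, `|A Y| <= `|Y| / 2) ->
  1%:M - lin_mx A \in unitmx.
Proof.
move=> hA; rewrite -row_free_unit; apply: inj_row_free => v.
rewrite mulmxBr mulmx1 mul_rV_lin => /subr0_eq hv.
have fixv : vec_mx v = A (vec_mx v) by rewrite -[RHS]mxvecK -hv.
have := hA (vec_mx v); rewrite -fixv => hle.
have /normr0_eq0 v0 : `|vec_mx v : 'M[R]_(m, n)| = 0.
  by have := normr_ge0 (vec_mx v : 'M[R]_(m, n)); lra.
by rewrite -[v]vec_mxK v0 linear0.
Qed.

Lemma affine_solve_unique A B Y : (forall Y, `|A Y| <= `|Y| / 2) ->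
  Y = A Y + B -> Y = affine_solve A B.
Proof.
move=> hA hY; rewrite /affine_solve.
have -> : mxvec B = mxvec Y *m (1%:M - lin_mx A).
  by rewrite mulmxBr mulmx1 mul_vec_lin -linearB /= {1}hY addrAC subrr add0r.
by rewrite mulmxK ?mxvecK //; exact: contraction_unitmx.
Qed.

Lemma affine_solve_sum A d (c : 'I_d -> R) (B : 'I_d -> 'M[R]_(m, n)) :
  affine_solve A (\sum_l c l *: B l) = \sum_l c l *: affine_solve A (B l).
Proof.
rewrite /affine_solve linear_sum mulmx_suml linear_sum.
by apply: eq_bigr => l _; rewrite linearZ -scalemxAl linearZ.
Qed.

Lemma class_C_affine_solve (V : normedModType R) k (U : set V)
    (A : V -> {linear 'M[R]_(m, n) -> 'M[R]_(m, n)}) (B : V -> 'M[R]_(m, n)) :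
  open U ->
  (forall x, U x -> forall Y, `|A x Y| <= `|Y| / 2) ->
  (forall Y i j, class_C k U (fun x => A x Y i j)) ->
  (forall i j, class_C k U (fun x => B x i j)) ->
  forall i j, class_C k U (fun x => affine_solve (A x) (B x) i j).
Proof.
move=> oU cA hA hB i j.
have -> : (fun x => affine_solve (A x) (B x) i j) = fun x =>
    \sum_l mxvec (B x) 0 l * invmx (1%:M - lin_mx (A x)) l (mxvec_index i j).
  by apply/funext => x; rewrite -mxvecE vec_mxK mxE.
apply: class_C_sum => // l _; apply: class_CM => //.
  case/mxvec_indexP: l => p q.
  by under eq_fun do rewrite mxvecE; exact: hB.
apply: class_C_invmx => // [p q|x Ux]; last by apply: contraction_unitmx; exact: cA.
have -> : (fun x => (1%:M - lin_mx (A x)) p q) =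
    fun x => (1%:M : 'M[R]_(m * n)) p q + (-1) * mxvec (A x (vec_mx (delta_mx 0 p))) 0 q.
  by apply/funext => x; rewrite !mxE mulN1r.
apply: class_CD => //; first exact: class_C_cst.
apply: class_CM => //; first exact: class_C_cst.
case/mxvec_indexP: q => r s.
by under eq_fun do rewrite mxvecE; exact: hA.
Qed.

End AffineSolve.

(** * Differentiability from factored increments *)

Section Increment.
Context {R : realType} {V : normedModType R}.

(** Caratheodory's criterion with a weight: as [c b - c a] vanishes to first
    order at a, continuity of g at a is enough, and g contributes only its value
    at a to the derivative. *)
Lemma increment_mul_diff (c g : V -> R) a :
  differentiable c a -> {for a, continuous g} ->
  differentiable (fun b => (c b - c a) * g b) a /\
  forall v, 'D_v (fun b => (c b - c a) * g b) a = 'D_v c a * g a.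
Proof.
move=> dc cg; set f := fun b => _.
have cdc : continuous ('d c a) by exact: diff_continuous.
pose df : {linear V -> R} := g a \*: 'd c a.
have cdf : continuous df.
  by move=> x; exact: continuousZl_tmp (cdc x).
have E : f \o shift a = cst (f a) + df +o_ 0 id.
  have /eqaddoP hc := diff_locally dc.
  have [K K0 hK] := linear_lipschitz cdc.
  apply/eqaddoP => e e0.
  have K1 : 0 < K + 1 by rewrite addr_gt0.
  have g1 : 0 < `|g a| + 1 by rewrite ltr_wpDl.
  have e1 : 0 < e / 2 / (K + 1) by rewrite !divr_gt0.
  have e2 : 0 < e / 2 / (`|g a| + 1) by rewrite !divr_gt0.
  have cg' : \forall h \near 0, `|g a - g (h + a)| <= e / 2 / (K + 1).
    have H : \forall y \near a, `|g a - g y| <= e / 2 / (K + 1).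
      exact: ((cvgrPdist_le _ _).1 cg _ e1).
    by rewrite (near_shift 0) subr0 in H.
  near=> h.
  have h1 : `|c (h + a) - c a - 'd c a h| <= `|h|.
    rewrite -[leRHS]mul1r.
    have : `|(c \o shift a - (cst (c a) + 'd c a)) h| <= 1 * `|id h|.
      by near: h; apply: hc.
    by rewrite !fctE /= opprD addrA.
  have h2 : `|c (h + a) - c a - 'd c a h| <= e / 2 / (`|g a| + 1) * `|h|.
    have : `|(c \o shift a - (cst (c a) + 'd c a)) h| <= e / 2 / (`|g a| + 1) * `|id h|.
      by near: h; apply: hc.
    by rewrite !fctE /= opprD addrA.
  have h3 : `|g a - g (h + a)| <= e / 2 / (K + 1) by near: h.
  have h4 : `|c (h + a) - c a| <= (K + 1) * `|h|.
    rewrite -[c (h + a) - c a](subrK ('d c a h)) mulrDl mul1r addrC.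
    by apply: le_trans (ler_normD _ _) _; rewrite lerD // hK.
  (* The remainder splits into a product of two increments, small because g is
     continuous, and the remainder of c, weighted by the constant g a. *)
  have -> : (f \o shift a - (cst (f a) + df)) h =
     (c (h + a) - c a) * (g (h + a) - g a) + (c (h + a) - c a - 'd c a h) * g a.
    rewrite !fctE /= /f /df /= /GRing.scale /=; ring.
  apply: le_trans (ler_normD _ _) _; rewrite !normrM (distrC (g _)) (splitr e) mulrDl.
  apply: lerD.
    apply: le_trans (ler_pM _ _ h4 h3) _ => //.
    by rewrite le_eqVlt; apply/orP; left; apply/eqP; field; rewrite gt_eqF.
  apply: le_trans (ler_wpM2r _ h2) _ => //.
  rewrite mulrAC; apply: ler_wpM2r => //.
  by rewrite mulrAC ler_pdivrMr // ler_wpM2l ?lerDl // divr_ge0 // ltW.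
have Ed := diff_unique cdf E.
have dfa : differentiable f a by apply/diff_locallyP; rewrite Ed.
by split=> // v; rewrite !deriveE // Ed /df /= /GRing.scale /= mulrC.
Unshelve. all: by end_near. Qed.

Lemma increment_sum_diff d (U : set V) (f : V -> R) (c g : 'I_d -> V -> R) a :
  open U -> U a ->
  (forall l, differentiable (c l) a) -> (forall l, {for a, continuous (g l)}) ->
  (forall b, U b -> f b - f a = \sum_l (c l b - c l a) * g l b) ->
  differentiable f a /\ forall v, 'D_v f a = \sum_l 'D_v (c l) a * g l a.
Proof.
move=> oU Ua dc cg incr.
pose h l b := (c l b - c l a) * g l b.
have hl l : differentiable (h l) a := (increment_mul_diff (dc l) (cg l)).1.
have fE : \forall b \near a, (cst (f a) + \sum_l h l) b = f b.
  near=> b; have Ub : U b by near: b; exact: open_nbhs_nbhs.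
  rewrite -[RHS](subrK (f a)) incr // [RHS]addrC; congr (_ + _).
  by rewrite fct_sumE.
have dh : differentiable (\sum_l h l) a by exact: differentiable_sum.
split.
  apply: near_eq_differentiable fE _.
  by apply: differentiableD => //; exact: differentiable_cst.
move=> v; rewrite -(near_eq_derive v fE) deriveD; last first.
- exact: diff_derivable.
- exact: derivable_cst.
rewrite derive_cst add0r derive_sum => [|l]; last exact: diff_derivable.
apply: eq_bigr => l _; exact: (increment_mul_diff (dc l) (cg l)).2.
Unshelve. all: by end_near. Qed.

End Increment.

(** * Smooth dependence of fixed points on parameters *)

Section MatrixNorm.
Context {R : realType} {m n : nat}.
Implicit Types M : 'M[R]_(m, n).

Lemma entry_le_norm M i j : `|M i j| <= `|M|.
Proof.
rewrite [leRHS]/Num.Def.normr /= mx_normrE.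
exact: (le_bigmax _ (fun ij : 'I_m * 'I_n => `|M ij.1 ij.2|) (i, j)).
Qed.

Lemma norm_le_entries M e : 0 <= e -> (forall i j, `|M i j| <= e) -> `|M| <= e.
Proof.
move=> e0 hM; rewrite [leLHS]/Num.Def.normr /= mx_normrE.
by apply: bigmax_le => // ij _; exact: hM.
Qed.

End MatrixNorm.

(** A family X of fixed points given through the factored form of its
    increments. The operator [A b x x'] is the divided difference of the map
    with parameter b between x and x', and [T l] is the part of the map that
    multiplies the scalar parameter [c l]. *)
Section SmoothFixedPoint.
Context {R : realType} {V : normedModType R} {m n d : nat}.
Variables (U : set V) (c : 'I_d -> V -> R) (X : V -> 'M[R]_(m, n)).
Variables (A : V -> 'M[R]_(m, n) -> 'M[R]_(m, n) ->
               {linear 'M[R]_(m, n) -> 'M[R]_(m, n)}).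
Variables (T : 'I_d -> 'M[R]_(m, n) -> 'M[R]_(m, n)).
Hypothesis (Uopen : open U) (c_smooth : forall l, smooth_on U (c l)).
Hypothesis increment : forall a b, U a -> U b ->
  X b - X a = A b (X b) (X a) (X b - X a) + \sum_l (c l b - c l a) *: T l (X a).
Hypothesis contracting : forall a b, U a -> U b ->
  forall Y, `|A b (X b) (X a) Y| <= `|Y| / 2.
Hypothesis A_smooth : forall k (Z Z' : V -> 'M[R]_(m, n)),
  (forall i j, class_C k U (fun b => Z b i j)) ->
  (forall i j, class_C k U (fun b => Z' b i j)) ->
  forall Y i j, class_C k U (fun b => A b (Z b) (Z' b) Y i j).
Hypothesis T_smooth : forall k (Z : V -> 'M[R]_(m, n)),
  (forall i j, class_C k U (fun b => Z b i j)) ->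
  forall l i j, class_C k U (fun b => T l (Z b) i j).

(** By contraction, [`|X b - X a| <= 2 * \sum_l `|c l b - c l a| * `|T l (X a)|]. *)
Lemma fixed_point_continuous i j : class_C 0 U (fun b => X b i j).
Proof.
move=> a Ua; apply/cvgrPdist_le => e e0.
pose S := \sum_l `|T l (X a)|.
have S0 : 0 <= S by exact: sumr_ge0.
have S1 : 0 < S + 1 by rewrite ltr_wpDl.
have e1 : 0 < e / 2 / (S + 1) by rewrite !divr_gt0.
have cn : \forall b \near a, forall l, `|c l a - c l b| <= e / 2 / (S + 1).
  apply: filter_forall => l; apply: (cvgrPdist_le _ _).1 e1.
  exact: (class_C_continuous (c_smooth l 0) Ua).
near=> b.
have Ub : U b by near: b; exact: open_nbhs_nbhs.
have hc l : `|c l a - c l b| <= e / 2 / (S + 1) by move: l; near: b.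
have hX : `|X b - X a| <= `|X b - X a| / 2 + e / 2.
  rewrite {1}increment //; apply: le_trans (ler_normD _ _) _.
  apply: lerD; first exact: contracting.
  apply: le_trans (ler_norm_sum _ _ _) _.
  apply: (@le_trans _ _ (e / 2 / (S + 1) * S)).
    rewrite mulr_sumr; apply: ler_sum => l _.
    by rewrite normrZ distrC ler_wpM2r.
  by rewrite mulrAC ler_pdivrMr // ler_wpM2l ?lerDl // divr_ge0 // ltW.
rewrite distrC; apply: le_trans (_ : `|X b - X a| <= e); last by lra.
by have := entry_le_norm (X b - X a) i j; rewrite !mxE.
Unshelve. all: by end_near. Qed.

(** Solving the increment equation for [X b - X a] leaves the increments of the
    parameters multiplied by functions of b that are continuous at a. *)
Lemma fixed_point_derivable i j a : U a ->
  differentiable (fun b => X b i j) a /\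
  forall v, 'D_v (fun b => X b i j) a =
    \sum_l 'D_v (c l) a * affine_solve (A a (X a) (X a)) (T l (X a)) i j.
Proof.
move=> Ua.
apply: (@increment_sum_diff _ _ _ U _ c
  (fun l b => affine_solve (A b (X b) (X a)) (T l (X a)) i j)) => // [l|l|b Ub].
- by have [/(_ a Ua)] := c_smooth l 1.
- apply: (class_C_continuous _ Ua); apply: (@class_C_affine_solve _ _ _ _ 0) => //.
  + by move=> b Ub; exact: (contracting Ua Ub).
  + apply: (A_smooth (Z := X) (Z' := fun=> X a)); first exact: fixed_point_continuous.
    by move=> ? ?; exact: class_C_cst.
  + by move=> ? ?; exact: class_C_cst.
have -> : X b i j - X a i j = (X b - X a) i j by rewrite !mxE.
rewrite {1}(affine_solve_unique (contracting Ua Ub) (increment Ua Ub)).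
by rewrite affine_solve_sum summxE; apply: eq_bigr => l _; rewrite mxE.
Qed.

(** The formula for the derivatives involves X itself and no derivative of X,
    so that class C^k of X gives class C^k of its derivatives. *)
Theorem smooth_fixed_point i j : smooth_on U (fun b => X b i j).
Proof.
move=> k; elim: k i j => [|k IH] i j; first exact: fixed_point_continuous.
split=> [a Ua|v]; first exact: (fixed_point_derivable i j Ua).1.
have h : class_C k U (fun a =>
    \sum_l 'D_v (c l) a * affine_solve (A a (X a) (X a)) (T l (X a)) i j).
  apply: class_C_sum => // l _; apply: class_CM => //.
    exact: (c_smooth l k.+1).2.
  apply: class_C_affine_solve => //.
  - by move=> b Ub; exact: (contracting Ub Ub).
  - exact: (A_smooth (Z := X) (Z' := X)).
  - exact: (T_smooth (Z := X)).
by apply: class_C_ext h => // a Ua; rewrite (fixed_point_derivable i j Ua).2.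
Qed.

End SmoothFixedPoint.

(** * Existence of fixed points *)

Section Banach.
Context {R : realType} {m n : nat}.

(** The ball of radius twice the initial displacement is mapped into itself,
    which localizes the fixed point quantitatively. *)
Lemma matrix_contraction_fixed_point (F : 'M[R]_(m, n) -> 'M[R]_(m, n)) x0 s :
  (forall x y, `|x - x0| <= s -> `|y - x0| <= s -> `|F x - F y| <= `|x - y| / 2) ->
  2 * `|F x0 - x0| <= s ->
  exists2 x, `|x - x0| <= 2 * `|F x0 - x0| & x = F x.
Proof.
move=> cF hs; set r := 2 * _.
(* Matrices carry a complete and a normed structure, joined here. *)
pose E : completeNormedModType R := HB.pack_for (completeNormedModType R) 'M[R]_(m, n).
pose B : set E := closed_ball_ (fun x : E => `|x|) x0 r.
have inB (x : E) : B x -> `|x - x0| <= r by rewrite /B /closed_ball_ /= distrC.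
have FB : {homo F : x / B x >-> B x}.
  move=> x Bx; have := cF x x0 (le_trans (inB _ Bx) hs); rewrite subrr normr0.
  move=> /(_ (le_trans (normr_ge0 _) (le_trans (inB _ Bx) hs))) h.
  rewrite /B /closed_ball_ /= distrC -[F x](subrK (F x0)) -addrA.
  apply: le_trans (ler_normD _ _) _.
  have := inB _ Bx; rewrite /r; lra.
pose G := mkfun FB : {fun B >-> B}.
have cG : is_contraction G.
  exists (2^-1)%:nng; split=> /=; first by lra.
  move=> [x y] [/= Bx By]; rewrite mulrC.
  by apply: cF; [exact: le_trans (inB _ Bx) hs|exact: le_trans (inB _ By) hs].
have [|x Bx Ex] := banach_fixed_point cG (@closed_closed_ball_ _ E x0 r).
  by exists x0; rewrite /B /closed_ball_ /= subrr normr0 mulr_ge0.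
by exists x; [exact: inB|exact: Ex].
Qed.

End Banach.

(** * The normalized stationary equations as a contraction *)

Section Chain.
Context {R : realType} {n : nat}.
Local Notation state := 'M[R]_(2, n.+2).
Implicit Types (x y : state) (g c e : R).

Lemma ord2P (i : 'I_2) : i = 0 \/ i = 1.
Proof. by case: i => [[|[|//]] h]; [left|right]; exact: val_inj. Qed.

Lemma laplacian_is_linear : linear (@laplacian R n).
Proof.
move=> a u v; apply/rowP => j; rewrite !mxE.
by case: (j == ord0); [ring|case: (j == ord_max); ring].
Qed.

HB.instance Definition _ :=
  GRing.isLinear.Build R _ _ _ (@laplacian R n) laplacian_is_linear.

Lemma laplacian_bound (u : 'rV[R]_n.+2) B j :
  (forall k, `|u 0 k| <= B) -> `|laplacian u 0 j| <= 4 * B.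
Proof.
move=> hu; have B0 : 0 <= B by exact: le_trans (hu ord0).
rewrite mxE; case: ifP => _; last case: ifP => _.
- have := hu (inord 1); have := hu ord0.
  by rewrite !ler_norml => /andP[? ?] /andP[? ?]; apply/andP; split; lra.
- have := hu (inord n); have := hu ord_max.
  by rewrite !ler_norml => /andP[? ?] /andP[? ?]; apply/andP; split; lra.
have := hu (inord j.+1); have := hu (inord j.-1); have := hu j.
rewrite !ler_norml => /andP[? ?] /andP[? ?] /andP[? ?].
by apply/andP; split; lra.
Qed.

(** The normalization of the equations at each site. At the first site the
    p-equation [p^3 - omega p - eps (Lap p) = 0] has derivative 2 at p = 1, and
    the factor -1/2 turns it into a Newton step; the zero weight on q, together
    with [cubic_part], encodes the condition q_1 = 0. *)
Definition weight (i : 'I_2) (j : 'I_n.+2) : R :=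
  if j == ord0 then (if i == 0 then - 2^-1 else 0) else 1.

(** The part of the fixed-point map that depends on the parameters, with
    g = gamma, c = 1 - omega and e = eps. It is linear in the state and in
    (g, c, e). *)
Definition linear_part g c e y : state :=
  \matrix_(i, j) (weight i j *
    (c * y i j - e * laplacian (row i y) 0 j
     + g * (j == ord_max)%:R * (if i == 0 then - y 1 j else y 0 j))).

(** The fixed-point map at gamma = eps = 0 and omega = 1. Its derivative at the
    base state vanishes: at the first site because (3 p - p^3) / 2 is critical
    at p = 1, elsewhere because the map is cubic at 0. *)
Definition cubic_part x : state :=
  \matrix_(i, j)
    if j == ord0 then (if i == 0 then (3 * x 0 j - x 0 j ^+ 3) / 2 else 0)
    else (x 0 j ^+ 2 + x 1 j ^+ 2) * x i j.

(** The exact divided difference of [cubic_part] between x and x', applied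
    to y. *)
Definition cubic_increment x x' y : state :=
  \matrix_(i, j)
    if j == ord0 then
      (if i == 0 then
         (3 - (x 0 j ^+ 2 + x 0 j * x' 0 j + x' 0 j ^+ 2)) / 2 * y 0 j
       else 0)
    else if i == 0 then
      (x 0 j ^+ 2 + x 0 j * x' 0 j + x' 0 j ^+ 2 + x 1 j ^+ 2) * y 0 j
      + x' 0 j * (x 1 j + x' 1 j) * y 1 j
    else
      (x 1 j ^+ 2 + x 1 j * x' 1 j + x' 1 j ^+ 2 + x 0 j ^+ 2) * y 1 j
      + x' 1 j * (x 0 j + x' 0 j) * y 0 j.

Definition breather_map g c e x : state := cubic_part x + linear_part g c e x.

Definition breather_increment g c e x x' y : state :=
  cubic_increment x x' y + linear_part g c e y.

Lemma linear_part_is_linear g c e : linear (linear_part g c e).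
Proof.
move=> a u v; apply/matrixP => i j; rewrite !mxE.
by case: (i == 0); case: (j == ord0); case: (j == ord_max); rewrite ?mxE; ring.
Qed.

HB.instance Definition _ g c e :=
  GRing.isLinear.Build R _ _ _ (linear_part g c e) (linear_part_is_linear g c e).

Lemma breather_increment_is_linear g c e x x' :
  linear (breather_increment g c e x x').
Proof.
move=> a u v; rewrite /breather_increment linearP scalerDr addrACA; congr (_ + _).
apply/matrixP => i j; rewrite !mxE.
by case: (j == ord0); case: (i == 0); ring.
Qed.

HB.instance Definition _ g c e x x' :=
  GRing.isLinear.Build R _ _ _ (breather_increment g c e x x')
    (breather_increment_is_linear g c e x x').

Lemma breather_incrementP g c e x x' :
  breather_map g c e x - breather_map g c e x' =
  breather_increment g c e x x' (x - x').
Proof.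
rewrite /breather_map /breather_increment linearB opprD addrACA; congr (_ + _).
apply/matrixP => i j; rewrite !mxE.
case: (j == ord0); case: (ord2P i) => -> /=; try field; ring.
Qed.

Lemma linear_part_decomp g c e x :
  linear_part g c e x = g *: linear_part 1 0 0 x + c *: linear_part 0 1 0 x
                        + e *: linear_part 0 0 1 x.
Proof. by apply/matrixP => i j; rewrite !mxE; ring. Qed.

Lemma linear_part_bound g c e y : 
  `|linear_part g c e y| <= (`|g| + `|c| + 4 * `|e|) * `|y|.
Proof.
set B := `|y|; have B0 : 0 <= B by exact: normr_ge0.
have yB i j : `|y i j| <= B by exact: entry_le_norm.
apply: norm_le_entries => [|i j]; first by rewrite mulr_ge0 // ?addr_ge0 // ?mulr_ge0.
have w1 : `|weight i j| <= 1.
  rewrite /weight; case: ifP => _; last by rewrite normr1.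
  by case: ifP => _; rewrite ?normr0 // normrN ger0_norm; lra.
rewrite mxE normrM -[leRHS]mul1r; apply: ler_pM => //.
have lB : `|laplacian (row i y) 0 j| <= 4 * B.
  by apply: laplacian_bound => k; rewrite mxE.
have gB : `|(j == ord_max)%:R * (if i == 0 then - y 1 j else y 0 j)| <= B.
  rewrite normrM -[leRHS]mul1r; apply: ler_pM => //.
    by case: (j == ord_max); rewrite ?normr1 ?normr0.
  by case: ifP => _; rewrite ?normrN yB.
rewrite -(mulrA g); apply: le_trans (ler_normD _ _) _.
apply: le_trans (lerD (ler_normB _ _) (lexx _)) _.
have -> : (`|g| + `|c| + 4 * `|e|) * B = `|c| * B + `|e| * (4 * B) + `|g| * B by ring.
by rewrite 3!normrM; do ![apply: lerD]; apply: ler_wpM2l.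
Qed.

Definition base_state : state := delta_mx 0 ord0.

(** Within 1/10 of the base state all coefficients are small: at the first site
    [3 - (u^2 + u v + v^2)] vanishes at u = v = 1, at the other sites the
    coefficients are quadratic in small quantities. *)
Lemma cubic_increment_bound x x' y :
  `|x - base_state| <= 1 / 10 -> `|x' - base_state| <= 1 / 10 ->
  `|cubic_increment x x' y| <= 2 / 5 * `|y|.
Proof.
move=> hx hx'; set B := `|y|; have B0 : 0 <= B by exact: normr_ge0.
have yB i j : `|y i j| <= B by exact: entry_le_norm.
have xb i j : `|x i j - base_state i j| <= 1 / 10.
  by apply: le_trans hx; have := entry_le_norm (x - base_state) i j; rewrite !mxE.
have xb' i j : `|x' i j - base_state i j| <= 1 / 10.
  by apply: le_trans hx'; have := entry_le_norm (x' - base_state) i j; rewrite !mxE.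
apply: norm_le_entries => [|i j]; first by rewrite mulr_ge0.
rewrite mxE; have [->|j0] := eqVneq j ord0.
  case: ifP => _; last by rewrite normr0 mulr_ge0.
  rewrite normrM; apply: ler_pM => //.
  have := xb 0 ord0; have := xb' 0 ord0; rewrite !mxE !eqxx /=.
  by rewrite !ler_norml => /andP[? ?] /andP[? ?]; apply/andP; split; nra.
have comb a b u v : `|a| <= 1 / 5 -> `|b| <= 1 / 5 -> `|u| <= B -> `|v| <= B ->
    `|a * u + b * v| <= 2 / 5 * B.
  move=> ha hb hu hv; apply: le_trans (ler_normD _ _) _; rewrite !normrM.
  have := ler_pM (normr_ge0 a) (normr_ge0 u) ha hu.
  have := ler_pM (normr_ge0 b) (normr_ge0 v) hb hv.
  lra.
have small i0 : `|x i0 j| <= 1 / 10 /\ `|x' i0 j| <= 1 / 10.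
  have := xb i0 j; have := xb' i0 j.
  by rewrite !mxE (negbTE j0) andbF !subr0; split.
have [[]] := (small 0, small 1).
rewrite ler_norml => /andP[? ?]; rewrite ler_norml => /andP[? ?] [].
rewrite ler_norml => /andP[? ?]; rewrite ler_norml => /andP[? ?].
case: ifP => _; apply: comb => //; rewrite ler_norml; apply/andP; split; nra.
Qed.

Lemma breather_increment_contraction g c e x x' y :
  `|x - base_state| <= 1 / 10 -> `|x' - base_state| <= 1 / 10 ->
  `|g| + `|c| + 4 * `|e| <= 1 / 20 ->
  `|breather_increment g c e x x' y| <= `|y| / 2.
Proof.
move=> hx hx' hs; apply: le_trans (ler_normD _ _) _.
have h1 := cubic_increment_bound y hx hx'.
have h2 := linear_part_bound g c e y.
have h3 := ler_wpM2r (normr_ge0 y) hs.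
have := normr_ge0 y; lra.
Qed.

Lemma breather_map_contraction g c e x y :
  `|g| + `|c| + 4 * `|e| <= 1 / 20 ->
  `|x - base_state| <= 1 / 10 -> `|y - base_state| <= 1 / 10 ->
  `|breather_map g c e x - breather_map g c e y| <= `|x - y| / 2.
Proof.
move=> hs hx hy; rewrite breather_incrementP.
exact: breather_increment_contraction.
Qed.

Lemma breather_map_base g c e :
  `|breather_map g c e base_state - base_state| <= `|g| + `|c| + 4 * `|e|.
Proof.
have -> : breather_map g c e base_state - base_state = linear_part g c e base_state.
  rewrite /breather_map addrAC -[RHS]add0r; congr (_ + _).
  apply/matrixP => i j; rewrite !mxE.
  by case: (eqVneq j ord0) => _; case: (ord2P i) => -> /=; field.
rewrite -[leRHS]mulr1; apply: le_trans (linear_part_bound _ _ _ _) _.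
apply: ler_wpM2l; first by rewrite ?addr_ge0 // ?mulr_ge0.
apply: norm_le_entries => // i j; rewrite mxE.
by case: (_ && _); rewrite ?normr1 ?normr0.
Qed.

Lemma breather_map_fixed_point g c e :
  `|g| + `|c| + 4 * `|e| <= 1 / 20 ->
  exists2 x, `|x - base_state| <= 2 * (`|g| + `|c| + 4 * `|e|) &
             x = breather_map g c e x.
Proof.
move=> hs; have hb := breather_map_base g c e.
have [||x hx Ex] :=
    @matrix_contraction_fixed_point R _ _ (breather_map g c e) base_state (1 / 10).
- by move=> x y; exact: breather_map_contraction.
- by lra.
by exists x => //; apply: le_trans hx _; lra.
Qed.

Lemma breather_map_fixed_point_unique g c e x y :
  `|g| + `|c| + 4 * `|e| <= 1 / 20 ->
  `|x - base_state| <= 1 / 10 -> `|y - base_state| <= 1 / 10 ->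
  x = breather_map g c e x -> y = breather_map g c e y -> x = y.
Proof.
move=> hs hx hy Ex Ey; have := breather_map_contraction hs hx hy.
rewrite -Ex -Ey => h; apply/subr0_eq/normr0_eq0.
by have := normr_ge0 (x - y); lra.
Qed.

End Chain.

(** * Stationary solutions, rotations and fixed points *)

Section Stationary.
Context {R : realType} {n : nat}.
Local Notation state := 'M[R]_(2, n.+2).
Implicit Types (x y : state) (p q : 'rV[R]_n.+2) (eps omega beta gamma : R).

Lemma breather_mapE g c e x i j :
  breather_map g c e x i j =
    (if j == ord0 then (if i == 0 then (3 * x 0 j - x 0 j ^+ 3) / 2 else 0)
     else (x 0 j ^+ 2 + x 1 j ^+ 2) * x i j)
    + weight i j * (c * x i j - e * laplacian (row i x) 0 j
       + g * (j == ord_max)%:R * (if i == 0 then - x 1 j else x 0 j)).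
Proof. by rewrite !mxE. Qed.

Lemma velocity_pE eps omega beta gamma p q j :
  velocity_p eps omega beta gamma p q 0 j =
    eps * laplacian q 0 j + omega * q 0 j - (p 0 j ^+ 2 + q 0 j ^+ 2) * q 0 j
    + beta * (j == ord0)%:R * p 0 ord0 - gamma * (j == ord_max)%:R * p 0 ord_max.
Proof. by rewrite mxE. Qed.

Lemma velocity_qE eps omega beta gamma p q j :
  velocity_q eps omega beta gamma p q 0 j =
    - (eps * laplacian p 0 j) - omega * p 0 j + (p 0 j ^+ 2 + q 0 j ^+ 2) * p 0 j
    + beta * (j == ord0)%:R * q 0 ord0 - gamma * (j == ord_max)%:R * q 0 ord_max.
Proof. by rewrite mxE. Qed.

Lemma stationary_entries eps omega beta gamma p q :
  stationary eps omega beta gamma p q <->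
  forall j, velocity_p eps omega beta gamma p q 0 j = 0 /\
            velocity_q eps omega beta gamma p q 0 j = 0.
Proof.
split=> [[hp hq] j|h]; first by rewrite hp hq mxE.
by split; apply/rowP => j; rewrite [RHS]mxE; have [] := h j.
Qed.

(** The p-equation at the first site, which is not part of the fixed-point
    equation, holds by the choice of beta, as q vanishes there. *)
Lemma fixed_point_stationary eps omega gamma x :
  x 0 ord0 != 0 -> x = breather_map gamma (1 - omega) eps x ->
  x 1 ord0 = 0 /\
  stationary eps omega (- (eps * laplacian (row 1 x) 0 ord0) / x 0 ord0) gamma
    (row 0 x) (row 1 x).
Proof.
move=> p0 Ex.
have E i j : x i j = breather_map gamma (1 - omega) eps x i j by rewrite -Ex.
have q0 : x 1 ord0 = 0.
  by rewrite E breather_mapE /weight /= mul0r addr0.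
split=> //; apply/stationary_entries => j; rewrite velocity_pE velocity_qE.
have := E 0 j; have := E 1 j; rewrite !breather_mapE /weight /=.
have r0 k : row 0 x 0 k = x 0 k by rewrite mxE.
have r1 k : row 1 x 0 k = x 1 k by rewrite mxE.
rewrite !r0 !r1.
have [->|j0] := eqVneq j ord0.
  rewrite q0 /= => _ E0; split; first by field.
  lra.
have [->|_] := eqVneq j ord_max; move=> /= E1 E0; split; lra.
Qed.

Definition pair_state p q : state := \matrix_(i, j) (if i == 0 then p else q) 0 j.

Lemma stationary_fixed_point eps omega beta gamma p q :
  q 0 ord0 = 0 -> stationary eps omega beta gamma p q ->
  pair_state p q = breather_map gamma (1 - omega) eps (pair_state p q) /\
  beta * p 0 ord0 = - (eps * laplacian q 0 ord0).
Proof.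
move=> q0 /stationary_entries h; split; last first.
  have [] := h ord0; rewrite velocity_pE q0 /= => + _; lra.
apply/matrixP => i j; rewrite breather_mapE.
have rp : row 0 (pair_state p q) = p by apply/rowP => k; rewrite !mxE.
have rq : row 1 (pair_state p q) = q by apply/rowP => k; rewrite !mxE.
have ep k : pair_state p q 0 k = p 0 k by rewrite mxE.
have eq k : pair_state p q 1 k = q 0 k by rewrite mxE.
have [] := h j; rewrite velocity_pE velocity_qE /weight.
have [->|j0] := eqVneq j ord0.
  by case: (ord2P i) => -> /=; rewrite ?rp ?rq !ep !eq q0 => hp hq; lra.
by have [->|_] := eqVneq j ord_max; case: (ord2P i) => -> /=;
  rewrite ?rp ?rq !ep !eq => hp hq; lra.
Qed.

Lemma stationary_rotation eps omega beta gamma p q c s :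
  c ^+ 2 + s ^+ 2 = 1 -> stationary eps omega beta gamma p q ->
  stationary eps omega beta gamma (c *: p - s *: q) (s *: p + c *: q).
Proof.
move=> cs /stationary_entries h; apply/stationary_entries => j.
have [] := h j; rewrite !velocity_pE !velocity_qE => hp hq.
have lp : laplacian (c *: p - s *: q) 0 j = c * laplacian p 0 j - s * laplacian q 0 j.
  by rewrite linearB !linearZ !mxE.
have lq : laplacian (s *: p + c *: q) 0 j = s * laplacian p 0 j + c * laplacian q 0 j.
  by rewrite linearD !linearZ !mxE.
have ep k : (c *: p - s *: q) 0 k = c * p 0 k - s * q 0 k by rewrite !mxE.
have eq k : (s *: p + c *: q) 0 k = s * p 0 k + c * q 0 k by rewrite !mxE.
rewrite lp lq !ep !eq.
have -> : (c * p 0 j - s * q 0 j) ^+ 2 + (s * p 0 j + c * q 0 j) ^+ 2 =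
          p 0 j ^+ 2 + q 0 j ^+ 2 by rewrite -[RHS]mul1r -cs; ring.
split.
  transitivity (c * 0 - s * 0 : R); last by ring.
  rewrite -{1}hp -hq; ring.
transitivity (s * 0 + c * 0 : R); last by ring.
rewrite -{1}hp -hq; ring.
Qed.

(** Rotation by the opposite of the argument of zeta_1, which is the arc tangent
    of q_1 / p_1 in the right half-plane. *)
Lemma rotate_to_positive_real p q : 0 < p 0 ord0 ->
  exists theta : R, exists p1 q1 : 'rV[R]_n.+2,
    [/\ p1 = cos theta *: p + sin theta *: q,
        q1 = - sin theta *: p + cos theta *: q,
        p = cos theta *: p1 - sin theta *: q1,
        q = sin theta *: p1 + cos theta *: q1 & q1 0 ord0 = 0 /\ 0 < p1 0 ord0].
Proof.
move=> p0; pose t := q 0 ord0 / p 0 ord0; pose theta := atan t.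
have c0 : 0 < cos theta.
  by rewrite cos_atan invr_gt0 sqrtr_gt0 ltr_wpDr ?sqr_ge0.
have st : sin theta = t * cos theta.
  by rewrite -[t in RHS]atanK -/theta /tan mulfVK ?gt_eqF.
have q0 : q 0 ord0 = t * p 0 ord0 by rewrite mulfVK ?gt_eqF.
have cs := cos2Dsin2 theta.
exists theta; eexists; eexists; split; try reflexivity.
- apply/rowP => j; rewrite !mxE -[LHS]mul1r -cs; ring.
- apply/rowP => j; rewrite !mxE -[LHS]mul1r -cs; ring.
split; rewrite !mxE q0 st; first by ring.
have -> : cos theta * p 0 ord0 + t * cos theta * (t * p 0 ord0) =
  cos theta * p 0 ord0 * (1 + t ^+ 2) by ring.
by rewrite !mulr_gt0 // ltr_wpDr ?sqr_ge0.
Qed.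

End Stationary.

(** * Smoothness of the normalized branch *)

(** Closes [class_C k U f] for f polynomial in functions for which the context
    has a hypothesis. *)
Ltac class_C_ring :=
  repeat first
    [ exact: class_C_cst | assumption
    | match goal with H : _ |- _ => exact: H end
    | apply: class_CD => // | apply: class_CM => //
    | apply: class_CN => // | apply: class_CX => // ].

Section Family.
Context {R : realType} {n : nat}.
Local Notation state := 'M[R]_(2, n.+2).
Local Notation parameter := (R * R * R)%type.

(** The parameter (gamma, omega, eps) enters [breather_map] through gamma,
    1 - omega and eps. *)
Definition coefficient (l : 'I_3) (x : parameter) : R :=
  if l == 0 then x.1.1 else if l == 1 then 1 - x.1.2 else x.2.

Lemma coefficient_smooth (U : set parameter) l : open U -> smooth_on U (coefficient l).
Proof.
move=> oU k.
have lin1 : linear (fun x : parameter => x.1.1) by [].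
have lin2 : linear (fun x : parameter => x.1.2) by [].
have lin3 : linear (fun x : parameter => x.2) by [].
pose f1 : {linear parameter -> R} :=
  HB.pack (fun x : parameter => x.1.1) (GRing.isLinear.Build _ _ _ _ _ lin1).
pose f2 : {linear parameter -> R} :=
  HB.pack (fun x : parameter => x.1.2) (GRing.isLinear.Build _ _ _ _ _ lin2).
pose f3 : {linear parameter -> R} :=
  HB.pack (fun x : parameter => x.2) (GRing.isLinear.Build _ _ _ _ _ lin3).
have c1 : class_C k U f1.
  by apply: class_C_linear => x; apply: cvg_comp; [exact: cvg_fst|exact: cvg_fst].
have c2 : class_C k U f2.
  by apply: class_C_linear => x; apply: cvg_comp; [exact: cvg_fst|exact: cvg_snd].
have c3 : class_C k U f3 by apply: class_C_linear => x; exact: cvg_snd.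
rewrite /coefficient; case: (l == 0) => //; case: (l == 1) => //.
by apply: class_CD => //; [exact: class_C_cst|exact: class_CN].
Qed.

Definition coefficient_part (l : 'I_3) : state -> state :=
  linear_part (l == 0)%:R (l == 1)%:R (l == 2)%:R.

(** The state is moved first, at parameter b, and then the parameter, at
    state y; the second step is exact because the map is affine in the
    coefficients. *)
Lemma breather_map_increment (a b : parameter) (x y : state) :
  breather_map b.1.1 (1 - b.1.2) b.2 x - breather_map a.1.1 (1 - a.1.2) a.2 y =
  breather_increment b.1.1 (1 - b.1.2) b.2 x y (x - y) +
  \sum_l (coefficient l b - coefficient l a) *: coefficient_part l y.
Proof.
rewrite -breather_incrementP -[LHS](subrKA (breather_map b.1.1 (1 - b.1.2) b.2 y)).
congr (_ + _); rewrite /breather_map opprD addrACA subrr add0r.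
rewrite linear_part_decomp [X in _ - X]linear_part_decomp.
rewrite !big_ord_recl big_ord0 addr0 /coefficient /coefficient_part /= !scalerBl.
by apply/matrixP => i j; rewrite ![in LHS]mxE ![in RHS]mxE; ring.
Qed.

Lemma breather_increment_smooth (U : set parameter) k (Z Z' : parameter -> state) :
  open U ->
  (forall i j, class_C k U (fun b => Z b i j)) ->
  (forall i j, class_C k U (fun b => Z' b i j)) ->
  forall Y i j, class_C k U (fun b =>
    breather_increment b.1.1 (1 - b.1.2) b.2 (Z b) (Z' b) Y i j).
Proof.
move=> oU hZ hZ' Y i j.
have c1 : class_C k U (fun b : parameter => b.1.1) := @coefficient_smooth U 0 oU k.
have c2 : class_C k U (fun b : parameter => 1 - b.1.2) := @coefficient_smooth U 1 oU k.
have c3 : class_C k U (fun b : parameter => b.2) := @coefficient_smooth U 2 oU k.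
under eq_fun do rewrite !mxE.
apply: class_CD => //; last by class_C_ring.
by case: (j == ord0); case: (i == 0); class_C_ring.
Qed.

Lemma coefficient_part_smooth (U : set parameter) k (Z : parameter -> state) :
  open U -> (forall i j, class_C k U (fun b => Z b i j)) ->
  forall l i j, class_C k U (fun b => coefficient_part l (Z b) i j).
Proof.
move=> oU hZ l i j; under eq_fun do rewrite !mxE.
by case: (j == ord0); case: (j == ord_max); case: (i == 0);
  (under eq_fun do rewrite ?mxE); class_C_ring.
Qed.

Lemma breather_family_smooth (U : set parameter) (X : parameter -> state) :
  open U ->
  (forall b, U b -> `|b.1.1| + `|1 - b.1.2| + 4 * `|b.2| <= 1 / 20) ->
  (forall b, U b -> `|X b - base_state| <= 1 / 10) ->
  (forall b, U b -> X b = breather_map b.1.1 (1 - b.1.2) b.2 (X b)) ->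
  forall i j, smooth_on U (fun b => X b i j).
Proof.
move=> oU hU hX EX i j.
apply: (@smooth_fixed_point _ _ _ _ _ U coefficient X
  (fun b x x' => breather_increment b.1.1 (1 - b.1.2) b.2 x x') coefficient_part) => //.
- by move=> l; exact: coefficient_smooth.
- by move=> a b Ua Ub; rewrite {1}(EX _ Ub) {1}(EX _ Ua) breather_map_increment.
- move=> a b Ua Ub Y.
  by apply: breather_increment_contraction; [exact: hX|exact: hX|exact: hU].
- by move=> k Z Z'; exact: breather_increment_smooth.
- by move=> k Z; exact: coefficient_part_smooth.
Qed.

End Family.

(** * Localization in a Euclidean ball *)

Section Distance.
Context {R : realType} {n : nat}.
Implicit Types (p q : 'rV[R]_n).

Lemma dist2_ge_entry p q p' q' j :
  (p 0 j - p' 0 j) ^+ 2 + (q 0 j - q' 0 j) ^+ 2 <= dist2 p q p' q' ^+ 2.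
Proof.
rewrite sqr_sqrtr; last by apply: sumr_ge0 => k _; rewrite addr_ge0 ?sqr_ge0.
rewrite (bigD1 j) //= lerDl.
by apply: sumr_ge0 => k _; rewrite addr_ge0 ?sqr_ge0.
Qed.

Lemma dist2_entry_l p q p' q' j : `|p 0 j - p' 0 j| <= dist2 p q p' q'.
Proof.
rewrite -(ler_pXn2r (n := 2)) ?nnegrE ?sqrtr_ge0 // real_normK ?num_real //.
by apply: le_trans (dist2_ge_entry p q p' q' j); rewrite lerDl sqr_ge0.
Qed.

Lemma dist2_entry_r p q p' q' j : `|q 0 j - q' 0 j| <= dist2 p q p' q'.
Proof.
rewrite -(ler_pXn2r (n := 2)) ?nnegrE ?sqrtr_ge0 // real_normK ?num_real //.
by apply: le_trans (dist2_ge_entry p q p' q' j); rewrite lerDr sqr_ge0.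
Qed.

Lemma dist2_le p q p' q' t : 0 <= t ->
  (forall j, `|p 0 j - p' 0 j| <= t) -> (forall j, `|q 0 j - q' 0 j| <= t) ->
  dist2 p q p' q' <= 2 * n%:R * t.
Proof.
move=> t0 hp hq.
have b0 : 0 <= 2 * n%:R * t by rewrite !mulr_ge0.
rewrite -(ler_pXn2r (n := 2)) ?nnegrE ?sqrtr_ge0 //.
rewrite sqr_sqrtr; last by apply: sumr_ge0 => k _; rewrite addr_ge0 ?sqr_ge0.
apply: (@le_trans _ _ (\sum_(j < n) 2 * t ^+ 2)).
  apply: ler_sum => j _; have := hp j; have := hq j.
  rewrite !ler_norml => /andP[? ?] /andP[? ?]; nra.
rewrite sumr_const card_ord -mulr_natr.
case: n => [|k]; first by rewrite !mulr0 mul0r expr0n.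
have k1 : 1 <= k.+1%:R :> R by rewrite ler1n.
have := sqr_ge0 t; nra.
Qed.

End Distance.

Section Normalization.
Context {R : realType} {n : nat}.
Implicit Types (p q : 'rV[R]_n.+2).

(** The rotation preserves every [|zeta_j|]; at the first site, zeta_1 becomes
    [|zeta_1|], whose distance to 1 is at most that of zeta_1. Passing from
    1/20 to 1/10 absorbs the factor between the sup norm and the Euclidean
    norm. *)
Lemma normalized_near_base p q p1 q1 c s :
  c ^+ 2 + s ^+ 2 = 1 -> p1 = c *: p + s *: q -> q1 = - s *: p + c *: q ->
  q1 0 ord0 = 0 -> 0 < p1 0 ord0 ->
  (forall j, `|p 0 j - (delta_mx 0 ord0 : 'rV[R]_n.+2) 0 j| <= 1 / 20) ->
  (forall j, `|q 0 j| <= 1 / 20) ->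
  `|pair_state p1 q1 - base_state| <= 1 / 10.
Proof.
move=> cs Ep Eq q0 p0 hp hq; apply: norm_le_entries => // i j.
have nrm : p1 0 j ^+ 2 + q1 0 j ^+ 2 = p 0 j ^+ 2 + q 0 j ^+ 2.
  by rewrite Ep Eq !mxE -[RHS]mul1r -cs; ring.
have norm_le (u t : R) : 0 <= t -> u ^+ 2 <= t ^+ 2 -> `|u| <= t.
  move=> t0 ut; rewrite -(ler_pXn2r (n := 2)) ?nnegrE //.
  by rewrite real_normK ?num_real.
have := hp j; have := hq j; rewrite !mxE eqxx /=.
have [jE|j0] := eqVneq j ord0.
  subst j; rewrite q0 /= in nrm *.
  rewrite !ler_norml => /andP[? ?] /andP[? ?].
  have hi : p1 0 ord0 <= 11 / 10.
    by rewrite -(ler_pXn2r (n := 2)) ?nnegrE ?(ltW p0) //; nra.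
  have lo : 9 / 10 <= p1 0 ord0.
    by rewrite -(ler_pXn2r (n := 2)) ?nnegrE ?(ltW p0) //; nra.
  by case: (ord2P i) => -> /=; rewrite ?q0; apply/andP; split; lra.
rewrite andbF !subr0 => hqj hpj.
have [] : `|p 0 j| ^+ 2 <= (1 / 20) ^+ 2 /\ `|q 0 j| ^+ 2 <= (1 / 20) ^+ 2.
  by rewrite !ler_pXn2r ?nnegrE.
rewrite !real_normK ?num_real // => ? ?.
have := sqr_ge0 (p1 0 j); have := sqr_ge0 (q1 0 j) => ? ?.
by case: (ord2P i) => -> /=; apply: norm_le => //; lra.
Qed.

End Normalization.

Section LocalUniqueness.
Context {R : realType} {n : nat}.
Implicit Types (x : 'M[R]_(2, n.+2)) (p q ps : 'rV[R]_n.+2).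

(** The normalizing rotation of a stationary solution near the base point is a
    fixed point in the contraction ball, so it is x. Since beta is unchanged by
    the rotation, the p-equation at the first site determines it too. *)
Lemma stationary_is_rotation eps omega gamma beta x ps p q :
  `|gamma| + `|1 - omega| + 4 * `|eps| <= 1 / 20 ->
  `|x - base_state| <= 1 / 10 -> x = breather_map gamma (1 - omega) eps x ->
  (forall j, `|ps 0 j - (delta_mx 0 ord0 : 'rV[R]_n.+2) 0 j| <= 1 / 40) ->
  dist2 p q ps 0 < 1 / 40 -> stationary eps omega beta gamma p q ->
  rotation_of (row 0 x) (row 1 x) p q /\
  beta * x 0 ord0 = - (eps * laplacian (row 1 x) 0 ord0).
Proof.
move=> small hx Ex hps hd st.
have hp j : `|p 0 j - (delta_mx 0 ord0 : 'rV[R]_n.+2) 0 j| <= 1 / 20.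
  apply: le_trans (ler_distD (ps 0 j) _ _) _.
  by have := hps j; have := dist2_entry_l p q ps 0 j; lra.
have hq j : `|q 0 j| <= 1 / 20.
  by have := dist2_entry_r p q ps 0 j; rewrite [X in _ - X]mxE subr0; lra.
have p0 : 0 < p 0 ord0.
  by have := hp ord0; rewrite mxE !eqxx /= ler_norml => /andP[]; lra.
have [theta [p1 [q1 [Ep1 Eq1 Ep Eq [q10 p10]]]]] := rotate_to_positive_real q p0.
have st1 : stationary eps omega beta gamma p1 q1.
  have := @stationary_rotation _ _ _ _ _ _ _ _ (cos theta) (- sin theta) _ st.
  by rewrite sqrrN cos2Dsin2 scaleNr opprK -Ep1 -Eq1; apply.
have [fix1 beta1] := stationary_fixed_point q10 st1.
have near1 := normalized_near_base (cos2Dsin2 theta) Ep1 Eq1 q10 p10 hp hq.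
have xE := breather_map_fixed_point_unique small hx near1 Ex fix1.
have rp : row 0 x = p1 by rewrite xE; apply/rowP => k; rewrite !mxE.
have rq : row 1 x = q1 by rewrite xE; apply/rowP => k; rewrite !mxE.
split; first by exists theta; rewrite rp rq.
by rewrite rq -beta1 xE mxE.
Qed.

End LocalUniqueness.

Theorem theorem2 (R : realType) (n : nat) (pstar : R -> R -> 'rV[R]_n.+2)
    (hpstar : undamped_breather pstar) :
  exists eps0 gamma0 Delta r : R,
    [/\ 0 < eps0, 0 < gamma0, 0 < Delta, 0 < r &
      (forall eps gamma omega : R,
         `|eps| < eps0 -> `|gamma| < gamma0 -> `|omega - 1| < Delta ->
         exists! beta : R, exists p q : 'rV[R]_n.+2,
           dist2 p q (pstar eps omega) 0 < r /\
           stationary eps omega beta gamma p q)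
      /\
      let U := [set x : R * R * R |
        [/\ `|x.1.1| < gamma0, `|x.1.2 - 1| < Delta & `|x.2| < eps0]] in
      exists P Q : R * R * R -> 'rV[R]_n.+2,
        [/\ smooth_on U P, smooth_on U Q &
            forall eps gamma omega : R,
              `|eps| < eps0 -> `|gamma| < gamma0 -> `|omega - 1| < Delta ->
              let p := P (gamma, omega, eps) in
              let q := Q (gamma, omega, eps) in
              [/\ q 0 ord0 = 0, 0 < p 0 ord0,
                  dist2 p q (pstar eps omega) 0 < r,
                  exists beta : R, stationary eps omega beta gamma p q &
                  forall (beta' : R) (p' q' : 'rV[R]_n.+2),
                    dist2 p' q' (pstar eps omega) 0 < r ->
                    stationary eps omega beta' gamma p' q' ->
                    rotation_of p q p' q']]].
Proof.
case: hpstar => eps1 [delta1 [eps1_gt0 delta1_gt0 [_ _ [C hC] _]]].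
pose K := `|C| + 1; have K1 : 1 <= K by rewrite lerDr.
pose N : R := n.+2%:R; have N2 : 2 <= N by rewrite (ler_nat _ 2).
(* For parameters below mu, the entries of the branch are within 12 mu of the
   base point, and those of the breather within 2 K mu, hence within tau of each
   other. A bound on entries costs at most a factor 2 N in Euclidean distance,
   and kappa makes the result smaller than the radius 1/40. *)
pose kappa := (160 * N * (12 + 2 * K))^-1.
have kappa_gt0 : 0 < kappa by rewrite invr_gt0 !mulr_gt0 //; lra.
have kappaE : (12 + 2 * K) * kappa * (2 * N) = 1 / 80.
  by rewrite /kappa; field; rewrite !gt_eqF //; lra.
pose mu := Num.min (Num.min eps1 delta1) kappa.
have mu_gt0 : 0 < mu by rewrite !lt_min eps1_gt0 delta1_gt0.
have mu_eps1 : mu <= eps1 by rewrite !ge_min lexx.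
have mu_delta1 : mu <= delta1 by rewrite !ge_min lexx orbT.
have mu_kappa : mu <= kappa by rewrite ge_min lexx orbT.
pose tau := (12 + 2 * K) * mu.
have tau_ge0 : 0 <= tau by rewrite mulr_ge0 //; lra.
have tauN : 2 * N * tau <= 1 / 80.
  rewrite -kappaE /tau mulrC; apply: ler_wpM2r; first by lra.
  by apply: ler_wpM2l => //; lra.
have tau_small : tau <= 1 / 320 by nra.
have mu_tau : 14 * mu <= tau by rewrite /tau; apply: ler_wpM2r; lra.
pose psize (b : R * R * R) := `|b.1.1| + `|1 - b.1.2| + 4 * `|b.2|.
pose U := [set x : R * R * R |
  [/\ `|x.1.1| < mu, `|x.1.2 - 1| < mu & `|x.2| < mu]].
have psize_mu b : U b -> 2 * psize b <= 12 * mu.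
  by case=> h1 h2 h3; rewrite /psize (distrC 1); lra.
pose F b := [set x : 'M[R]_(2, n.+2) |
  `|x - base_state| <= 2 * psize b /\ x = breather_map b.1.1 (1 - b.1.2) b.2 x].
pose X b := xget base_state (F b).
have psize_small b : U b -> psize b <= 1 / 20 by move=> /psize_mu; lra.
have X_spec b : U b -> `|X b - base_state| <= 2 * psize b /\
    X b = breather_map b.1.1 (1 - b.1.2) b.2 (X b).
  move=> Ub; have [x hx Ex] := @breather_map_fixed_point R n _ _ _ (psize_small b Ub).
  exact: (@xgetI _ base_state (F b) x (conj hx Ex)).
have X_near b : U b -> `|X b - base_state| <= 12 * mu.
  by move=> Ub; apply: le_trans (X_spec b Ub).1 (psize_mu b Ub).
have X_base b : U b -> `|X b - base_state| <= 1 / 10 by move=> /X_near; lra.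
(* In the sup norm of the parameter space U is a ball. *)
have openU : open U.
  have -> : U = ball ((0, 1, 0) : R * R * R) mu.
    apply/seteqP; split=> -[[g w] e] /=.
      by case=> ? ? ?; do !split; rewrite /ball /= ?sub0r ?normrN // distrC.
    by case=> -[]; rewrite /ball /= !sub0r !normrN distrC.
  exact: ball_open.
have X_smooth i j : smooth_on U (fun b => X b i j).
  by apply: breather_family_smooth => // b Ub; exact: (X_spec b Ub).2.
have pstar_near eps omega : `|eps| < mu -> `|omega - 1| < mu ->
    forall j, `|pstar eps omega 0 j - (delta_mx 0 ord0 : 'rV[R]_n.+2) 0 j| <= 2 * K * mu.
  move=> he ho j.
  have [|h1 h2] := hC eps omega; first by split=> /=; lra.
  have CK t : 0 <= t -> C * t <= K * t.
    by move=> t0; apply: ler_wpM2r => //; rewrite /K; have := ler_norm C; lra.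
  rewrite mxE eqxx /=; have [->|j0] := eqVneq j ord0.
    apply: le_trans h1 _; apply: le_trans (CK _ _) _; first by rewrite addr_ge0.
    rewrite (distrC 1); nra.
  rewrite subr0; apply: le_trans (h2 j j0) _.
  apply: le_trans (CK _ _) _; first by rewrite exprn_ge0.
  have : `|eps| ^+ j <= `|eps|.
    case: j {h1 h2} j0 => -[|j] //= hj _.
    rewrite exprS ler_piMr // exprn_ile1 //; nra.
  nra.
have main eps gamma omega : `|eps| < mu -> `|gamma| < mu -> `|omega - 1| < mu ->
    let x := X (gamma, omega, eps) in
    [/\ x 1 ord0 = 0, 0 < x 0 ord0,
        dist2 (row 0 x) (row 1 x) (pstar eps omega) 0 < 1 / 40,
        exists beta, stationary eps omega beta gamma (row 0 x) (row 1 x) &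
        forall beta p q, dist2 p q (pstar eps omega) 0 < 1 / 40 ->
          stationary eps omega beta gamma p q ->
          rotation_of (row 0 x) (row 1 x) p q /\
          beta * x 0 ord0 = - (eps * laplacian (row 1 x) 0 ord0)].
  move=> he hg ho x; pose b : R * R * R := (gamma, omega, eps).
  have Ub : U b by [].
  have [_ Ex] := X_spec b Ub; rewrite -/x /= in Ex.
  have hx i j : `|x i j - base_state i j| <= 12 * mu.
    apply: le_trans (X_near b Ub).
    by have := entry_le_norm (x - base_state) i j; rewrite !mxE.
  have x0 : 0 < x 0 ord0.
    by have := hx 0 ord0; rewrite mxE !eqxx /= ler_norml => /andP[]; lra.
  have [x1 st] := fixed_point_stationary (lt0r_neq0 x0) Ex.
  split=> //; last 2 first.
  - by eexists; exact: st.
  - move=> beta p q; apply: stationary_is_rotation (psize_small b Ub) (X_base b Ub) Ex _.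
    move=> j; apply: le_trans (pstar_near _ _ he ho j) _.
    by rewrite /tau in tau_small; lra.
  apply: le_lt_trans (dist2_le tau_ge0 _ _) _ => [j|j|].
  - rewrite mxE; apply: le_trans (ler_distD (base_state 0 j) _ _) _.
    have := hx 0 j; have := pstar_near _ _ he ho j; rewrite (distrC (base_state _ _)).
    have -> : (delta_mx 0 ord0 : 'rV[R]_n.+2) 0 j = base_state 0 j by rewrite !mxE !eqxx.
    by rewrite /tau; lra.
  - rewrite !mxE subr0.
    by have := hx 1 j; rewrite mxE /= subr0; lra.
  - by apply: le_lt_trans tauN _; lra.
exists mu, mu, mu, (1 / 40); split=> //.
split=> [eps gamma omega he hg ho|].
  have [_ x0 near [beta st] uniq] := main eps gamma omega he hg ho.
  exists beta; split; first by do 2!eexists; split; [exact: near|exact: st].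
  move=> beta' [p [q [hd st']]]; apply: (mulIf (lt0r_neq0 x0)).
  by rewrite (uniq _ _ _ near st).2 (uniq _ _ _ hd st').2.
exists (fun b => row 0 (X b)), (fun b => row 1 (X b)); split.
- move=> k; apply: class_C_mx => // i j.
  have -> : (fun b => row 0 (X b) i j) = fun b => X b 0 j.
    by apply/funext => b; rewrite mxE.
  exact: X_smooth.
- move=> k; apply: class_C_mx => // i j.
  have -> : (fun b => row 1 (X b) i j) = fun b => X b 1 j.
    by apply/funext => b; rewrite mxE.
  exact: X_smooth.
move=> eps gamma omega he hg ho /=.
have [x1 x0 near st uniq] := main eps gamma omega he hg ho.
split; rewrite ?mxE //.
by move=> beta p q hd st'; exact: (uniq _ _ _ hd st').1.
Qed.
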